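(* Let $X$ be a compact metric space and let $F\subset X\times X$ be a closed relation on $X$. If for some $n\in\mathbb{N}$ the set $X_F^n$ contains two disjoint nonempty closed sets $K$ and $L$ such that $\pi_1(K)\cup\pi_1(L)\subset\pi_{n+1}(K)\cap\pi_{n+1}(L)$ (i.e., $F$ is CR-turbulent), then $ent(\sigma_F^+)>0$.
   Context: $\mathbb{N}$ denotes the positive integers. A closed relation on $X$ is a closed subset of $X\times X$. For a closed relation $F$ on $X$ and $m\in\mathbb{N}$, $X_F^m=\{(x_1,\dots,x_{m+1})\in X^{m+1}: (x_i,x_{i+1})\in F \text{ for } 1\le i\le m\}$, and $X_F^+=\{(x_1,x_2,\dots)\in\prod_{i=1}^\infty X: (x_i,x_{i+1})\in F \text{ for all } i\in\mathbb{N}\}$ (product topology). The shift map $\sigma_F^+:X_F^+\to X_F^+$ is $\sigma_F^+(x_1,x_2,\dots)=(x_2,x_3,\dots)$. $\pi_i$ is the projection to the $i$-th coordinate, so $\pi_{n+1}$ is the last coordinate on $X_F^n\subset X^{n+1}$. $ent(f)$ is the topological entropy (Adler–Konheim–McAndrew) of a continuous self-map $f$ of a compact metric space: $ent(f)=\sup_\alpha \lim_{m\to\infty}\frac{1}{m}\log N(\vee_{i=0}^m f^{-i}(\alpha))$, where $\alpha$ ranges over open covers, $\vee$ denotes the common refinement of covers, and $N(\beta)$ is the minimal cardinality of a subcover of $\beta$. *)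

(* Defs.v *)
From mathcomp Require Import all_boot all_order all_algebra.
From mathcomp Require Import all_classical all_reals all_analysis.

Set Implicit Arguments.
Unset Strict Implicit.
Unset Printing Implicit Defensive.

Import Order.TTheory GRing.Theory Num.Theory.
Import numFieldNormedType.Exports.

Local Open Scope classical_set_scope.
Local Open Scope ring_scope.

Section Entropy.
Context {T : Type}.
Implicit Types a b : set (set T).

Definition is_cover a := \bigcup_(U in a) U = [set: T].

Definition cover_join a b : set (set T) := [set U `&` V | U in a & V in b].

Definition cover_preimage (g : T -> T) a : set (set T) :=
  [set g @^-1` U | U in a].

(* [[set [set: T]]] is neutral for [cover_join]: for m >= 0 this is the join
   of the m + 1 covers f^{-i}(a), 0 <= i <= m *)
Definition iterated_join (f : T -> T) a (m : nat) : set (set T) :=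
  \big[cover_join/[set [set: T]]]_(i < m.+1) cover_preimage (iter i f) a.

Definition has_subcover_card b (n : nat) :=
  exists c, [/\ c `<=` b, is_cover c & (c #= `I_n)%card].

(* the least cardinality of a subcover; 0 if there is no finite subcover, which
   does not happen for an open cover of a compact space *)
Definition min_subcover_card b : nat :=
  xget 0%N [set n | has_subcover_card b n /\
                    forall k, has_subcover_card b k -> (n <= k)%N].

End Entropy.

Definition is_open_cover {T : topologicalType} (a : set (set T)) :=
  a `<=` open /\ is_cover a.

(* Adler-Konheim-McAndrew entropy. It is meant for a continuous map on a compact
   space, where the limit exists for every open cover; [R] is only the field of
   values. The division by 0 in the term m = 0 does not affect the limit. *)
Definition cover_entropy (R : realType) {T : topologicalType} (f : T -> T)
    (a : set (set T)) : R :=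
  limn (fun m : nat =>
    m%:R^-1 * ln (min_subcover_card (iterated_join f a m))%:R).

Definition entropy (R : realType) {T : topologicalType} (f : T -> T) : \bar R :=
  ereal_sup [set (cover_entropy R f a)%:E | a in @is_open_cover T].

Section ClosedRelations.
Context {X : topologicalType}.
Implicit Type F : set (X * X).

(* x_1, ..., x_(m+1) are indexed by 'I_m.+1, so pi_1 and pi_(m+1) are the
   evaluations at [ord0] and [ord_max] *)
Definition mahavier F (m : nat) : set {ptws 'I_m.+1 -> X} :=
  [set x | forall i : 'I_m, F (x (widen_ord (leqnSn m) i), x (lift ord0 i))].
Arguments mahavier F m : clear implicits.

Definition mahavier_inf F : set {ptws nat -> X} :=
  [set x | forall i : nat, F (x i, x i.+1)].

Lemma mahavier_inf_shift F (x : mahavier_inf F) :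
  (fun i => val x i.+1) \in mahavier_inf F.
Proof. by apply/mem_set => i; exact: (set_mem (valP x)). Qed.

(* [mahavier_inf F], seen as a type, has the subspace topology *)
Definition shift_map F (x : mahavier_inf F) : mahavier_inf F :=
  SigSub (mahavier_inf_shift x).

Definition CR_turbulent F :=
  exists2 n : nat, (0 < n)%N &
  exists K L : set {ptws 'I_n.+1 -> X},
    [/\ [/\ K `<=` mahavier F n, closed K & K !=set0],
        [/\ L `<=` mahavier F n, closed L & L !=set0],
        K `&` L = set0 &
        (@^~ ord0 @` K) `|` (@^~ ord0 @` L) `<=`
        (@^~ ord_max @` K) `&` (@^~ ord_max @` L)].

End ClosedRelations.

(* Main.v *)
Require Import Defs.
From HB Require Import structures.
From mathcomp Require Import all_boot all_order all_algebra.
From mathcomp Require Import all_classical all_reals all_analysis.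
From mathcomp Require Import lra.
Import Order.TTheory GRing.Theory Num.Theory.
Import numFieldNormedType.Exports.

Local Open Scope classical_set_scope.
Local Open Scope ring_scope.

(** The shift map has a horseshoe. A point of [K] or [L] is a path of [n] steps
  along [F]; since every starting point of such a path is the end point of some
  path in [K] and of some path in [L], paths can be concatenated backwards in
  any prescribed order, so every finite word over the alphabet {K, L} is the
  itinerary, read at the times 0, n, 2n, ..., of some path. Concatenation only
  extends a path to the left, so infinite words are reached by compactness of
  the product: a cluster point of paths following longer and longer prefixes of
  an infinite word follows the whole word, because [K] and [L] are closed
  ([infinite_itinerary]).

  Let [K'] and [L'] be the sets of points of the shift space whose first [n]
  steps lie in [K], resp. in [L]. They are closed and disjoint, so their
  complements form an open cover. Two points that follow different words up to
  time [m] cannot share an element of the join of the first [m + 1] preimages of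
  this cover: at a time where the words differ, being in a common element of
  the cover would keep one of the two points off the set that it visits. Hence a
  subcover of that join has at least 2 ^ (m %/ n + 1) elements, and the entropy
  is at least ln 2 / n > 0 ([horseshoe_entropy_gt0]).

  The entropy of a cover is a limit, and the bound transfers to it only once the
  limit is known to exist. That is Fekete's lemma ([fekete]), applied to the
  logarithms of the least cardinalities of subcovers, which are subadditive
  because the join over [m + n] times is the join over [m] times refined by the
  [m]-th preimage of the join over [n] times
  ([min_subcover_card_dynamical_joinD]). *)

(** * Joins of covers and least subcovers *)

Section CoverJoin.
#[local] Set Implicit Arguments.
#[local] Unset Strict Implicit.
Context {T : Type}.
Implicit Types (a b c : set (set T)) (g : T -> T).

Lemma cover_joinA : associative (@cover_join T).
Proof.
move=> a b c; apply/seteqP; split=> W /=.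
- move=> [U aU [_ [V bV [V' cV' <-]] <-]].
  exists (U `&` V); first by exists U => //; exists V.
  by exists V' => //; rewrite setIA.
- move=> [_ [U aU [V bV <-]] [V' cV' <-]].
  exists U => //; exists (V `&` V'); last by rewrite setIA.
  by exists V => //; exists V'.
Qed.

Lemma cover_join1l : left_id [set [set: T]] (@cover_join T).
Proof.
move=> a; apply/seteqP; split=> W /=.
- by move=> [_ -> [V aV <-]]; rewrite setTI.
- by move=> aW; exists setT => //; exists W => //; rewrite setTI.
Qed.

Lemma cover_join1r : right_id [set [set: T]] (@cover_join T).
Proof.
move=> a; apply/seteqP; split=> W /=.
- by move=> [V aV [_ -> <-]]; rewrite setIT.
- by move=> aW; exists W => //; exists setT => //; rewrite setIT.
Qed.

(** The monoid structure gives access to the splitting lemmas for the big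
  operator that defines iterated joins. *)
HB.instance Definition _ := Monoid.isLaw.Build
  (set (set T)) [set [set: T]] (@cover_join T)
  cover_joinA cover_join1l cover_join1r.

Lemma cover_preimage_join g :
  {morph cover_preimage g : a b / cover_join a b}.
Proof.
move=> a b; apply/seteqP; split=> W /=.
- move=> [_ [U aU [V bV <-]] <-]; exists (g @^-1` U); first by exists U.
  by exists (g @^-1` V) => //; exists V.
- move=> [_ [U aU <-] [_ [V bV <-] <-]]; exists (U `&` V) => //.
  by exists U => //; exists V.
Qed.

Lemma cover_preimage1 g : cover_preimage g [set [set: T]] = [set [set: T]].
Proof. by rewrite /cover_preimage image_set1 preimage_setT. Qed.

Lemma is_coverP a : is_cover a <-> forall x, exists2 U, a U & U x.
Proof.
split=> [ca x|ca].
  by have : [set: T] x by []; rewrite -ca => -[U ? ?]; exists U.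
by apply/seteqP; split=> // x _; have [U] := ca x; exists U.
Qed.

Lemma is_cover_join a b : is_cover a -> is_cover b -> is_cover (cover_join a b).
Proof.
move=> /is_coverP ca /is_coverP cb; apply/is_coverP => x.
have [[U aU Ux] [V bV Vx]] := (ca x, cb x).
by exists (U `&` V) => //; exists U => //; exists V.
Qed.

Lemma is_cover_preimage g a : is_cover a -> is_cover (cover_preimage g a).
Proof.
move=> /is_coverP ca; apply/is_coverP => x; have [U aU Ux] := ca (g x).
by exists (g @^-1` U) => //; exists U.
Qed.

Lemma finite_cover_join a b :
  finite_set a -> finite_set b -> finite_set (cover_join a b).
Proof. exact: finite_image2. Qed.

Lemma finite_cover_preimage g a :
  finite_set a -> finite_set (cover_preimage g a).
Proof. exact: finite_image. Qed.

(** One subcover of finite cardinality is enough to leave the default value 0 of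
  [min_subcover_card]. *)
Lemma min_subcover_card_spec b n : has_subcover_card b n ->
  has_subcover_card b (min_subcover_card b) /\ (min_subcover_card b <= n)%N.
Proof.
move=> bn.
have ex : exists n, `[< has_subcover_card b n >].
  by exists n; apply/asboolP.
have [m /asboolP bm mP] := ex_minnP ex.
suff : [set n | has_subcover_card b n /\
    forall k, has_subcover_card b k -> (n <= k)%N] !=set0.
  rewrite /min_subcover_card => /(xgetPex 0%N)[bmin minP].
  by split=> //; exact: minP.
by exists m; split=> // k /asboolP; exact: mP.
Qed.

Lemma min_subcover_cardP b : finite_set b -> is_cover b ->
  has_subcover_card b (min_subcover_card b).
Proof.
move=> /finite_setP[n bn] cb.
have [|//] := @min_subcover_card_spec b n; by exists b; split.
Qed.

Lemma min_subcover_card_le b c n : c `<=` b -> is_cover c ->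
  (c #<= `I_n)%card -> (min_subcover_card b <= n)%N.
Proof.
move=> cb cc cn.
have /finite_setP[k ck] : finite_set c by apply/finite_set_leP; exists n.
apply: (@leq_trans k); last by rewrite -card_le_II -(card_le_eql ck).
have [|//] := @min_subcover_card_spec b k; by exists c.
Qed.

Lemma min_subcover_card_preimage g a : finite_set a -> is_cover a ->
  (min_subcover_card (cover_preimage g a) <= min_subcover_card a)%N.
Proof.
move=> fa /(min_subcover_cardP fa)[c [ca cc ck]].
apply: (@min_subcover_card_le _ (cover_preimage g c)).
- exact: image_subset.
- exact: is_cover_preimage.
- by rewrite -(card_le_eqr ck); exact: card_image_le.
Qed.

Lemma min_subcover_card_join a b :
  finite_set a -> is_cover a -> finite_set b -> is_cover b ->
  (min_subcover_card (cover_join a b) <=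
   min_subcover_card a * min_subcover_card b)%N.
Proof.
move=> fa /(min_subcover_cardP fa)[c [ca cc ck]].
move=> fb /(min_subcover_cardP fb)[d [db cd dk]].
set p := min_subcover_card a in ck *; set q := min_subcover_card b in dk *.
apply: (@min_subcover_card_le _ (cover_join c d)).
- by move=> _ [U cU [V dV <-]]; exists U; [exact: ca|exists V => //; exact: db].
- exact: is_cover_join.
(* a surjection from p * q indices onto the join, by Euclidean division by q *)
have /card_set_bijP[u [_ _ us]] : (`I_p #= c)%card by rewrite card_eq_sym.
have /card_set_bijP[v [_ _ vs]] : (`I_q #= d)%card by rewrite card_eq_sym.
pose uv k := u (k %/ q)%N `&` v (k %% q)%N.
suff -> : cover_join c d = uv @` `I_(p * q) `&` cover_join c d.
  exact: card_le_trans (subset_card_le (@subIsetl _ _ _)) (card_image_le _ _).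
apply/seteqP; split=> [W|W []//] [U cU [V dV <-]].
split; last by exists U => //; exists V.
have [i /= ip <-] := us _ cU; have [j /= jq <-] := vs _ dV.
exists (i * q + j)%N.
  apply: (@leq_trans (i.+1 * q)); first by rewrite mulSn addnC ltn_add2r.
  by rewrite leq_mul2r ip orbT.
have q0 : (0 < q)%N by exact: leq_ltn_trans jq.
by rewrite /uv divnMDl// divn_small// addn0 modnMDl modn_small.
Qed.

(** Pigeonhole: each point lies in some element of an optimal subcover, and no
  element may serve two points. *)
Lemma card_le_min_subcover_card (I : finType) (P : I -> T) b :
  finite_set b -> is_cover b ->
  (forall V i j, b V -> V (P i) -> V (P j) -> i = j) ->
  (#|I| <= min_subcover_card b)%N.
Proof.
move=> fb cb sep; have [c [sc /is_coverP cc ck]] := min_subcover_cardP fb cb.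
set k := min_subcover_card b in ck *.
have /card_set_bijP[v [vf _ vs]] : (`I_k #= c)%card by rewrite card_eq_sym.
have /choice[h hP] (i : I) : exists l : 'I_k, v l (P i).
  have [V cV Vi] := cc (P i); have [l /= lk lV] := vs _ cV.
  by exists (Ordinal lk); rewrite /= lV.
rewrite -[leqRHS]card_ord; apply: (@leq_card _ _ h) => i j hij.
have vj : v (h i) (P j) by rewrite hij.
by apply: sep (hP i) vj; apply: sc; apply: vf; exact: ltn_ord.
Qed.

(** [iterated_join f a m] joins [m + 1] preimages; indexing by the number of
  preimages instead makes the cardinalities of subcovers submultiplicative. *)
Definition dynamical_join (f : T -> T) a (n : nat) : set (set T) :=
  \big[cover_join/[set [set: T]]]_(i < n) cover_preimage (iter i f) a.

Variables (f : T -> T) (a : set (set T)).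

Lemma dynamical_join0 : dynamical_join f a 0 = [set [set: T]].
Proof. by rewrite /dynamical_join big_ord0. Qed.

Lemma dynamical_joinS n : dynamical_join f a n.+1 =
  cover_join (dynamical_join f a n) (cover_preimage (iter n f) a).
Proof. by rewrite /dynamical_join big_ord_recr. Qed.

Lemma dynamical_joinD m n : dynamical_join f a (m + n) =
  cover_join (dynamical_join f a m)
    (cover_preimage (iter m f) (dynamical_join f a n)).
Proof.
rewrite /dynamical_join big_split_ord /=; congr cover_join.
rewrite (big_morph _ (cover_preimage_join (iter m f)) (cover_preimage1 _)).
apply: eq_bigr => i _; rewrite /cover_preimage image_comp.
apply: eq_imagel => U _; apply/funext => x.
by rewrite /preimage /= addnC iterD.
Qed.

Lemma dynamical_join_sub n W i : dynamical_join f a n W -> (i < n)%N ->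
  exists2 U, a U & W `<=` iter i f @^-1` U.
Proof.
elim: n W => // n IH W; rewrite dynamical_joinS => -[V /IH IV [_ [U aU <-] <-]].
rewrite ltnS leq_eqVlt => /predU1P[->|/IV[U' aU' VU']].
  by exists U => //; exact: subIsetr.
by exists U' => //; apply: subset_trans VU'; exact: subIsetl.
Qed.

Hypotheses (fa : finite_set a) (ca : is_cover a).

Lemma is_cover_dynamical_join n : is_cover (dynamical_join f a n).
Proof.
elim: n => [|n IH].
  by rewrite dynamical_join0; apply/is_coverP => x; exists setT.
rewrite dynamical_joinS; apply: is_cover_join => //.
exact: is_cover_preimage.
Qed.

Lemma finite_dynamical_join n : finite_set (dynamical_join f a n).
Proof.
elim: n => [|n IH]; first by rewrite dynamical_join0; exact: finite_set1.
rewrite dynamical_joinS; apply: finite_cover_join => //.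
exact: finite_cover_preimage.
Qed.

(** Taking preimages cannot increase the least cardinality of a subcover, so the
  preimage in [dynamical_joinD] costs nothing. *)
Lemma min_subcover_card_dynamical_joinD m n :
  (min_subcover_card (dynamical_join f a (m + n)) <=
   min_subcover_card (dynamical_join f a m) *
   min_subcover_card (dynamical_join f a n))%N.
Proof.
have [fj cj] := (finite_dynamical_join, is_cover_dynamical_join).
rewrite dynamical_joinD.
apply: leq_trans (min_subcover_card_join _ _ _ _) _ => //.
- exact: finite_cover_preimage.
- exact: is_cover_preimage.
by rewrite leq_mul2l min_subcover_card_preimage ?orbT.
Qed.

End CoverJoin.

(** * Fekete's lemma *)

Section Fekete.
Context {R : realType} (u : nat -> R).
Hypotheses (u_ge0 : forall n, 0 <= u n)
  (u_sub : forall m n, u (m + n)%N <= u m + u n).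

Lemma subadditive_muln q p r : u (q * p + r)%N <= q%:R * u p + u r.
Proof.
elim: q => [|q IH]; first by rewrite mul0n add0n mul0r add0r.
rewrite mulSn -addnA (le_trans (u_sub _ _))// -natr1 mulrDl mul1r.
by rewrite (addrC (q%:R * _)) -addrA lerD2l.
Qed.

(** The limit is the infimum of [u n / n] over [n > 0]. If [u P / P] is close to
  it, then writing [n = q * P + r] bounds [u n / n] by [u P / P] plus a term
  [u r / n], which vanishes since only finitely many remainders [r] occur. *)
Lemma fekete : cvgn (fun n => u n / n%:R).
Proof.
pose S := [set u n.+1 / n.+1%:R | n in [set: nat]].
have hS : has_inf S.
  split; first by exists (u 1 / 1), 0%N.
  by exists 0 => _ [n _ <-]; rewrite divr_ge0.
apply/cvg_ex; exists (inf S); apply/cvgrPdist_le => e e0.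
have [_ [p _ <-] pS] := inf_adherent (divr_gt0 e0 (ltr0n R 2)) hS.
set P := p.+1 in pS.
pose M := \sum_(r < P) u r.
have uM r : (r < P)%N -> u r <= M.
  move=> rP; rewrite /M (bigD1 (Ordinal rP))//= lerDl.
  exact: sumr_ge0.
near=> n.
have n0 : (0 < n)%N by near: n; exact: nbhs_infty_gt.
have nM : M / (e / 2) <= n%:R by near: n; exact: nbhs_infty_ger.
have nR : 0 < n%:R :> R by rewrite ltr0n.
have lo : inf S <= u n / n%:R.
  by apply: (ge_inf hS.2); exists n.-1 => //; rewrite prednK.
have up : u n / n%:R <= u P / P%:R + M / n%:R.
  rewrite ler_pdivrMr// mulrDl divfK ?gt_eqF//.
  rewrite {1}(divn_eq n P) (le_trans (subadditive_muln _ _ _))// lerD//.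
    rewrite mulrC -mulrA ler_wpM2l// ler_pdivlMl ?ltr0n//.
    by rewrite mulrC -natrM ler_nat leq_divM.
  by apply: uM; rewrite ltn_mod.
have Mn : M / n%:R <= e / 2.
  by rewrite ler_pdivrMr// mulrC -ler_pdivrMr// divr_gt0.
rewrite distrC ger0_norm ?subr_ge0//; lra.
Unshelve. all: by end_near.
Qed.

(** The index shift matches [cover_entropy], where the join of [n + 1] covers is
  divided by [n]. *)
Lemma fekete_succ : cvgn (fun n => n%:R^-1 * u n.+1).
Proof.
have /cvg_ex[/= l ul] := fekete.
apply/cvg_ex; exists l.
have inv0 : (n%:R^-1 : R) @[n --> \oo] --> 0.
  by rewrite -cvg_shiftS; exact: cvg_harmonic.
apply: (@squeeze_cvgr _ _ _ _ (fun n => u n.+1 / n.+1%:R)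
  (fun n => u n / n%:R + u 1 * n%:R^-1)).
- near=> n; have n0 : (0 < n)%N by near: n; exact: nbhs_infty_gt.
  apply/andP; split.
    by rewrite mulrC ler_wpM2r// lef_pV2 ?posrE ?ltr0n// ler_nat.
  by rewrite -mulrDl mulrC ler_wpM2r ?invr_ge0// -addn1 u_sub.
- by move: ul; rewrite -cvg_shiftS.
- rewrite -[l]addr0 -[X in l + X](mulr0 (u 1)).
  by apply: cvgD => //; apply: cvgM => //; exact: cvg_cst.
Unshelve. all: by end_near.
Qed.
End Fekete.

(** * Entropy of a map with a horseshoe *)

(** The point [x] excludes the empty space, where the least cardinalities would
  be 0 and their logarithms meaningless. *)
Lemma is_cvg_cover_entropy (R : realType) (T : topologicalType) (x : T)
    (f : T -> T) (a : set (set T)) : finite_set a -> is_cover a ->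
  cvgn (fun m => m%:R^-1 * ln (min_subcover_card (iterated_join f a m))%:R : R).
Proof.
move=> fa ca; pose N n := min_subcover_card (dynamical_join f a n).
have N_gt0 n : (0 < N n)%N.
  have := @card_le_min_subcover_card T unit (fun _ => x) (dynamical_join f a n).
  rewrite card_unit; apply; last by move=> V [] [].
    exact: finite_dynamical_join.
  exact: is_cover_dynamical_join.
apply: (@fekete_succ R (fun n => ln (N n)%:R)) => [n|m n].
  by rewrite ln_ge0// ler1n.
rewrite -lnM ?posrE ?ltr0n// ler_ln ?posrE ?mulr_gt0 ?ltr0n// -natrM ler_nat.
exact: min_subcover_card_dynamical_joinD.
Qed.

(** The complements of the two sets form an open cover whose elements record
  which set is avoided. An element of the iterated join therefore
  determines the word followed by any of the points [x w] that it contains. *)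
Lemma horseshoe_entropy_gt0 (R : realType) (T : topologicalType) (f : T -> T)
    (S : bool -> set T) (p : nat) :
  (0 < p)%N -> (forall b, closed (S b)) -> S true `&` S false = set0 ->
  (forall w : nat -> bool, exists x, forall j, S (w j) (iter (j * p) f x)) ->
  (0 < entropy R f)%E.
Proof.
move=> p0 clS disjS /choice[x xP].
have sepS b c y : S b y -> S c y -> b = c.
  have no z : S true z -> S false z -> False.
    by move=> Sz S'z; have : (S true `&` S false) z by []; rewrite disjS.
  by case: b; case: c => // ? ?; case: (no y).
pose a := range (fun b => ~` S b).
have fa : finite_set a by exact: finite_image.
have ca : is_cover a.
  apply/is_coverP => y; have [Sy|nSy] := pselect (S true y).
    by exists (~` S false); [exists false|move/(sepS _ _ _ Sy)].
  by exists (~` S true) => //; exists true.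
have oa : a `<=` open by move=> _ [b _ <-]; exact: closed_openC.
(* a word of length J + 1, made infinite by repeating its first letter, which is
   what inord returns out of range *)
pose word J (w : {ffun 'I_J.+1 -> bool}) (j : nat) := w (inord j).
have growth m : (2 ^ (m %/ p).+1 <= min_subcover_card (iterated_join f a m))%N.
  set J := (m %/ p)%N.
  rewrite -[X in (X ^ _)%N]card_bool -[X in (_ ^ X)%N]card_ord -card_ffun.
  apply: (@card_le_min_subcover_card _ _ (fun w => x (word J w))).
  - exact: finite_dynamical_join.
  - exact: is_cover_dynamical_join.
  move=> V w w' aV Vw Vw'; apply/ffunP => j.
  have jm : (j * p < m.+1)%N.
    by rewrite ltnS -leq_divRL// -ltnS ltn_ord.
  have [_ [b _ <-] VS] := dynamical_join_sub aV jm.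
  (* the element b of the alphabet is excluded at time j, so the other one is
     forced *)
  have nb v : V (x (word J v)) -> v j != b.
    move=> /VS /= nS; apply/eqP => vb; apply: nS; rewrite -vb.
    by have := xP (word J v) j; rewrite /word inord_val.
  by move: (nb _ Vw) (nb _ Vw'); case: b {VS nb}; case: (w j); case: (w' j).
have ln2 : 0 < ln 2 / p%:R :> R by rewrite divr_gt0 ?ltr0n// ln_gt0// ltr1n.
apply: (@lt_le_trans _ _ (cover_entropy R f a)%:E); last first.
  by apply: ereal_sup_ubound; exists a.
rewrite lte_fin (lt_le_trans ln2)//; apply: limr_ge.
  exact: (is_cvg_cover_entropy _ _ (x xpredT)).
near=> m; have m0 : (0 < m)%N by near: m; exact: nbhs_infty_gt.
rewrite /= ler_pdivrMr ?ltr0n// -mulrA ler_pdivlMl ?ltr0n//.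
apply: (@le_trans _ _ (ln 2 *+ (m %/ p).+1 * p%:R)); last first.
  rewrite ler_wpM2r// -lnXn// ler_ln ?posrE ?exprn_gt0//; last first.
    by rewrite ltr0n (leq_trans _ (growth m))// expn_gt0.
  by rewrite -natrX ler_nat.
rewrite mulrC -[X in _ <= X * _]mulr_natr -mulrA ler_wpM2l ?ln_ge0 ?ler1n//.
by rewrite -natrM ler_nat ltnW// ltn_ceil.
Unshelve. all: by end_near.
Qed.

(** * Paths with prescribed itineraries *)

Section Itineraries.
Context {X : topologicalType} (n : nat).

Definition window (k : nat) (x : {ptws nat -> X}) : {ptws 'I_n.+1 -> X} :=
  fun i => x (k + i)%N.

Lemma window_continuous k : continuous (window k).
Proof.
move=> x; have ? : Filter (window k y @[y --> x]).
  by apply: fmap_filter; apply: nbhs_filter.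
apply/cvg_sup => i; apply/cvg_image.
  (* constant sequences show that the evaluation at i is onto *)
  by apply/seteqP; split=> // y _; exists (fun=> y).
apply: cvg_trans (@proj_continuous nat (fun=> X) (k + i)%N x).
move=> U; rewrite /= => xU.
exists (@^~ i @^-1` U); first exact: xU.
by apply/seteqP; split=> [_ [y Uy <-]//|y Uy]; exists (fun=> y).
Qed.

Variable S : bool -> set {ptws 'I_n.+1 -> X}.
Hypothesis S_link : forall b c, (@^~ ord0 @` S b) `<=` (@^~ ord_max @` S c).

(** Induction on the length of the word, putting a new path in front: the link
  condition provides a path in [S (w 0)] ending where the path for the rest of
  the word starts. The claim on [x 0] keeps that starting point within reach of
  the link condition. *)
Lemma finite_itinerary (J : nat) (w : nat -> bool) : S true !=set0 ->
  exists x : nat -> X, (exists b, (@^~ ord0 @` S b) (x 0)) /\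
    forall j, (j < J)%N -> S (w j) (window (j * n) x).
Proof.
move=> [s Ss]; elim: J w => [|J IH] w.
  by exists (fun=> s ord0); split=> //; exists true, s.
have [x [[b x0] xS]] := IH (fun j => w j.+1).
have [y Sy yx] := S_link b (w 0) _ x0.
pose z i := if (i < n)%N then y (inord i) else x (i - n)%N.
have z0 : window 0 z = y.
  apply/funext => i; rewrite /window /z add0n; case: ltnP => [_|ni].
    by rewrite inord_val.
  (* the end of y and the start of x, which agree by the link condition *)
  have -> : i = ord_max by apply/val_inj/eqP; rewrite eqn_leq ni -ltnS ltn_ord.
  by rewrite subnn -yx.
exists z; split.
  by exists (w 0); exists y => //; rewrite -z0.
case=> [_|j jJ]; first by rewrite mul0n z0.
suff -> : window (j.+1 * n) z = window (j * n) x by exact: xS.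
apply/funext => i; rewrite /window /z mulSn -addnA ltnNge leq_addr /=.
by rewrite addKn.
Qed.

Hypotheses (cptX : compact [set: X]) (clS : forall b, closed (S b)).

(** Concatenation never extends a path to the right, so a path following an
  infinite word is obtained as a cluster point of paths following its
  prefixes. *)
Lemma infinite_itinerary (w : nat -> bool) : S true !=set0 ->
  exists x : nat -> X, forall j, S (w j) (window (j * n) x).
Proof.
move=> S0; have /choice[x xP] J := finite_itinerary J w S0.
have cpt : compact [set: {ptws nat -> X}].
  have := tychonoff (fun _ : nat => cptX).
  by congr compact; apply/seteqP; split.
have [|z [_ zx]] := cpt (x @ \oo) _; first exact: filterT.
exists z => j; have cw := @window_continuous (j * n)%N.
apply: ((continuous_closedP _).1 cw _ (clS (w j))).
move: zx; rewrite clusterE; apply.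
by exists j.+1 => // k /= jk; exact: (xP k).2.
Qed.
End Itineraries.

Lemma iter_shift_map (X : topologicalType) (F : set (X * X)) k
    (x : mahavier_inf F) i :
  val (iter k (@shift_map X F) x) i = val x (k + i)%N.
Proof. by elim: k i => // k IH i; rewrite iterS /= IH addSnnS. Qed.

(** Consecutive windows overlap in one coordinate, so together they contain
  every pair of consecutive coordinates. *)
Lemma mahavier_inf_windows (X : topologicalType) (F : set (X * X)) n
    (x : nat -> X) : (0 < n)%N ->
  (forall j, mahavier F (window n (j * n) x)) -> mahavier_inf F x.
Proof.
move=> n0 xF i; have := xF (i %/ n)%N (Ordinal (ltn_pmod i n0)).
by rewrite /window /= /bump /= addnCA add1n -divn_eq.
Qed.

Theorem theorem3p2 (R : realType) (X : metricType R) (F : set (X * X)) :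
  compact [set: X] -> closed F -> CR_turbulent F ->
  (0 < entropy R (@shift_map X F))%E.
Proof.
move=> cptX _ [n n0 [K [L [[KF clK K0] [LF clL _] KL link]]]].
pose S b := if b then K else L.
have clS b : closed (S b) by case: b.
have SF b : S b `<=` mahavier F (m := n) by case: b.
have S_link b c : @^~ ord0 @` S b `<=` @^~ ord_max @` S c.
  move=> x Sx; have [] := link x; first by case: b Sx; [left|right].
  by case: c.
apply: (@horseshoe_entropy_gt0 R _ _
  (fun b => [set x : mahavier_inf F | S b (window n 0 (val x))]) n n0).
- move=> b.
  have cv : continuous (val : mahavier_inf F -> {ptws nat -> X}).
    exact: initial_continuous.
  apply: (continuous_closedP _).1 (clS b) => x.
  exact: continuous_comp (cv x) (@window_continuous _ _ _ _).
- apply/seteqP; split=> // x [Kx Lx].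
  by have : (K `&` L) (window n 0 (val x)) by []; rewrite KL.
move=> w; have [x xS] := infinite_itinerary _ _ S_link cptX clS w K0.
have Fx : mahavier_inf F x.
  by apply: (mahavier_inf_windows _ _ n) => // j; exact: SF (xS j).
exists (SigSub (mem_set Fx)) => j /=.
set y := SigSub _.
have -> : window n 0 (val (iter (j * n) (@shift_map X F) y)) =
    window n (j * n) x.
  by apply/funext => i; rewrite /window iter_shift_map add0n.
exact: xS.
Qed.
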